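(* Let $A\in\mathbb{C}^{n\times n}$ be a matrix whose spectrum is in the open right half-plane $\{z\in\mathbb{C}:\mathrm{Re}(z)>0\}$. Then there exist a parameter $\eta\in(1,\infty)$ and a (non-unique) Hermitian positive definite $P\in\mathbb{C}^{n\times n}$ such that $A\in\mathbf{L}_P(\eta)$. Moreover, the matrix $\frac12(A+A^{-1})$ is well defined and, with the same $P$ and $\eta$, belongs to $\mathbf{L}_P\left(\frac12\left(\eta+\frac1\eta\right)\right)$.
   Context: For Hermitian matrices, $M\succ N$ means $M-N$ is positive definite. For $P\succ 0$ and $\eta\in(1,\infty)$, $$\mathbf{L}_P(\eta)=\{A\in\mathbb{C}^{n\times n}:PA+A^*P\succ\tfrac1\eta(A^*PA+P)\}.$$ *)

(* Defs.v *)
From mathcomp Require Import all_boot all_order all_algebra.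
From mathcomp Require Import complex.
From mathcomp Require Import classical_sets reals.

Set Implicit Arguments.
Unset Strict Implicit.
Unset Printing Implicit Defensive.

Import GRing.Theory Num.Theory.

Local Open Scope classical_set_scope.
Local Open Scope ring_scope.
Local Open Scope complex_scope.
Local Open Scope sesquilinear_scope.

(* The order of R[i] is partial: 0 < z means that z is real and positive. *)
Definition posdefmx (R : realType) (n : nat) (M : 'M[R[i]]_n) : Prop :=
  M \is hermsymmx /\
  forall v : 'cV[R[i]]_n, v != 0 -> 0 < (v ^t* *m M *m v) 0 0.

Definition mxsucc (R : realType) (n : nat) (M N : 'M[R[i]]_n) : Prop :=
  posdefmx (M - N).

(* The two sides compared below are Hermitian as soon as P is. *)
Definition LP (R : realType) (n : nat) (P : 'M[R[i]]_n) (eta : R) :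
    set 'M[R[i]]_n :=
  [set A | mxsucc (P *m A + A ^t* *m P)
                  (eta^-1%:C *: (A ^t* *m P *m A + P))].

Definition spectrum (R : realType) (n : nat) (A : 'M[R[i]]_n) : set R[i] :=
  [set z | eigenvalue A z].

(* Main.v *)
Require Import Defs.
From mathcomp Require Import all_boot all_order all_algebra.
From mathcomp Require Import complex.
From mathcomp Require Import classical_sets reals.
From mathcomp Require Import ring.

(* For the quadratic form q of P, membership of A in L_P(eta) means that the Cayley transform
   (A - 1)(A + 1)^-1 is a strict contraction with ratio (eta - 1)/(eta + 1) on squared
   P-norms. The map A |-> (A + A^-1)/2 squares the Cayley transform, and
   eta |-> (eta + eta^-1)/2 squares the ratio, whence the second part. For the existence of P,
   triangularize A by a unitary matrix (Schur) and conjugate by a geometric diagonal matrix to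
   make the off-diagonal entries small: the result S has S + S^* strictly diagonally
   dominant, hence positive definite, and stays so after subtracting eta^-1 (S^* S + 1) for
   large eta. *)

Set Implicit Arguments.
Unset Strict Implicit.
Unset Printing Implicit Defensive.

Import Order.TTheory GRing.Theory Num.Theory.

Local Open Scope classical_set_scope.
Local Open Scope ring_scope.
Local Open Scope sesquilinear_scope.

Section HermitianForms.
Variable C : numClosedFieldType.

(** * Conjugate transposes and quadratic forms *)

Lemma trmxCE m n (A : 'M[C]_(m, n)) i j : A^t* i j = (A j i)^*.
Proof. by rewrite !mxE. Qed.

Lemma trmxC_mul m n p (A : 'M[C]_(m, n)) (B : 'M[C]_(n, p)) :
  (A *m B)^t* = B^t* *m A^t*.
Proof. by rewrite trmx_mul map_mxM. Qed.

Lemma trmxCD m n (A B : 'M[C]_(m, n)) : (A + B)^t* = A^t* + B^t*.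
Proof. by rewrite linearD map_mxD. Qed.

Lemma trmxCB m n (A B : 'M[C]_(m, n)) : (A - B)^t* = A^t* - B^t*.
Proof. by rewrite linearB map_mxB. Qed.

Lemma trmxCZ m n a (A : 'M[C]_(m, n)) : (a *: A)^t* = a^* *: A^t*.
Proof. by rewrite linearZ map_mxZ. Qed.

Lemma trmxC1 n : (1%:M : 'M[C]_n)^t* = 1%:M.
Proof. by rewrite trmx1 map_mx1. Qed.

Lemma trmxC_invol m n (A : 'M[C]_(m, n)) : (A^t*)^t* = A.
Proof. by apply/matrixP => i j; rewrite !mxE conjCK. Qed.

Lemma hermsymmxP n (M : 'M[C]_n) : reflect (M^t* = M) (M \is hermsymmx).
Proof.
apply: (iffP (is_hermitianmxP _ _ _)); rewrite expr0 scale1r; exact: esym.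
Qed.

Definition qform n (M : 'M[C]_n) (v : 'cV[C]_n) : C := (v^t* *m M *m v) 0 0.

Lemma qformD n (M N : 'M[C]_n) v : qform (M + N) v = qform M v + qform N v.
Proof. by rewrite /qform mulmxDr mulmxDl mxE. Qed.

Lemma qformZ n a (M : 'M[C]_n) v : qform (a *: M) v = a * qform M v.
Proof. by rewrite /qform -scalemxAr -scalemxAl mxE. Qed.

Lemma qformB n (M N : 'M[C]_n) v : qform (M - N) v = qform M v - qform N v.
Proof. by rewrite -scaleN1r qformD qformZ mulN1r. Qed.

Lemma qform_congr n (M B : 'M[C]_n) v :
  qform (B^t* *m M *m B) v = qform M (B *m v).
Proof. by rewrite /qform trmxC_mul !mulmxA. Qed.

Lemma qform0 n (M : 'M[C]_n) : qform M 0 = 0.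
Proof. by rewrite /qform mulmx0 mxE. Qed.

Lemma qformZv n (M : 'M[C]_n) a v : qform M (a *: v) = `|a| ^+ 2 * qform M v.
Proof.
rewrite /qform trmxCZ -scalemxAr -!scalemxAl !mxE mulrA normCK; congr (_ * _).
Qed.

Lemma qform_sum n (M : 'M[C]_n) v :
  qform M v = \sum_i \sum_j (v i 0)^* * M i j * v j 0.
Proof.
rewrite exchange_big /qform !mxE; apply: eq_bigr => j _.
by rewrite !mxE mulr_suml; apply: eq_bigr => i _; rewrite !mxE.
Qed.

Lemma qform_real n (M : 'M[C]_n) v : M \is hermsymmx -> qform M v \is Num.real.
Proof.
move=> /hermsymmxP hM; apply/CrealP.
have -> : (qform M v)^* = ((v^t* *m M *m v)^t*) 0 0 by rewrite trmxCE.
by rewrite !trmxC_mul hM trmxC_invol mulmxA.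
Qed.

Lemma hermsymmx_diag_real n (M : 'M[C]_n) i :
  M \is hermsymmx -> M i i \is Num.real.
Proof. by move=> /hermsymmxP hM; apply/CrealP; rewrite -[in RHS]hM !mxE. Qed.

Lemma norm_hermsymmxC n (M : 'M[C]_n) i j :
  M \is hermsymmx -> `|M i j| = `|M j i|.
Proof. by move=> /hermsymmxP hM; rewrite -[in LHS]hM !mxE norm_conjC. Qed.

(** * Diagonal dominance *)

Definition row_dominant n (M : 'M[C]_n) :=
  forall i, \sum_(j | j != i) `|M i j| < M i i.

(** Gershgorin-type estimate: with weights [|v i|^2], the cross terms are at most the weighted
    off-diagonal row sums, and dominance puts these below the diagonal terms. *)
Lemma row_dominant_qform_gt0 n (M : 'M[C]_n) v :
  M \is hermsymmx -> row_dominant M -> v != 0 -> 0 < qform M v.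
Proof.
move=> hM dM v0; pose w i := `|v i 0| ^+ 2.
have w_ge0 i : 0 <= w i by rewrite exprn_ge0.
pose off := \sum_i \sum_(j | j != i) (v i 0)^* * M i j * v j 0.
have qE : qform M v = \sum_i w i * M i i + off.
  rewrite qform_sum -big_split; apply: eq_bigr => i _ /=.
  by rewrite (bigD1 i) //=; congr (_ + _); rewrite /w normCK; ring.
(* The order on [C] is partial, so [off] has to be real before [- off <= |off|] can be used. *)
have dgR : \sum_i w i * M i i \is Num.real.
  by apply: rpred_sum => i _; rewrite rpredM ?hermsymmx_diag_real ?ger0_real.
have offR : off \is Num.real.
  rewrite (_ : off = qform M v - \sum_i w i * M i i); last by rewrite qE; ring.
  by rewrite rpredB ?qform_real.
(* [2 |v i| |v j| <= |v i|^2 + |v j|^2]; the two halves agree by symmetry. *)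
have off_le : `|off| <= \sum_i w i * \sum_(j | j != i) `|M i j|.
  pose S := \sum_i \sum_(j | j != i) w i * `|M i j|.
  have SE : S = \sum_i \sum_(j | j != i) w j * `|M i j|.
    rewrite /S (exchange_big_dep predT) //=; apply: eq_bigr => i _.
    rewrite (eq_bigl (fun j => j != i)); last by move=> j; rewrite eq_sym.
    by apply: eq_bigr => j _; rewrite norm_hermsymmxC.
  under eq_bigr do rewrite mulr_sumr.
  rewrite -/S -(ler_pM2l (ltr0n C 2)) [leRHS]mulr_natl [leRHS]mulr2n {2}SE -big_split.
  apply: le_trans (ler_wpM2l (ler0n C 2) (ler_norm_sum _ _ _)) _.
  rewrite mulr_sumr; apply: ler_sum => i _; rewrite -big_split /=.
  apply: le_trans (ler_wpM2l (ler0n C 2) (ler_norm_sum _ _ _)) _.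
  rewrite mulr_sumr; apply: ler_sum => j _; rewrite -mulrDl !normrM norm_conjC.
  rewrite mulrAC mulrA ler_wpM2r // -subr_ge0.
  have -> : w i + w j - 2 * (`|v i 0| * `|v j 0|) = (`|v i 0| - `|v j 0|) ^+ 2.
    by rewrite /w; ring.
  by rewrite -realEsqr rpredB ?normr_real.
rewrite qE -(opprK off) subr_gt0.
apply: le_lt_trans (_ : _ <= `|off|) _.
  by rewrite -normrN real_ler_norm // rpredN.
apply: le_lt_trans off_le _.
(* A nonzero coordinate makes one summand strict; the others only need a weak inequality. *)
have [i vi0] : exists i, v i 0 != 0.
  apply/existsP; apply: contra_neqT v0 => /existsPn v0.
  by apply/matrixP => i j; rewrite ord1 mxE; apply/eqP; have := v0 i; rewrite negbK.
rewrite (bigD1 i) //= [ltRHS](bigD1 i) //=.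
apply: ltr_leD.
  by rewrite ltr_pM2l // exprn_gt0 // normr_gt0.
by apply: ler_sum => j _; rewrite ler_wpM2l // ltW.
Qed.

(** This supplies both large constants of the construction: the [e] that becomes eta, and the ratio
    [h] of the geometric scaling. *)
Lemma uniform_multiplier (I : finType) (b g : I -> C) :
  (forall i, 0 <= b i) -> (forall i, 0 < g i) ->
  exists2 e, 1 < e & forall i, b i < e * g i.
Proof.
move=> b0 g0; have bg0 i : 0 <= b i / g i by rewrite divr_ge0 // ltW.
(* The sum bounds every single ratio; the added 2 gives strictness and a value above 1. *)
exists (2 + \sum_i b i / g i).
  by rewrite ltr_wpDr ?sumr_ge0 // ltr1n.
move=> i; rewrite -ltr_pdivrMr // (bigD1 i) //= addrCA ltr_pwDr //.
by rewrite ltr_wpDr ?sumr_ge0.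
Qed.

(** Each row of [H] has a positive margin. The full row sum of [|K i j|] pays for the change on and
    off the diagonal together, so [e] only has to bring it below the margin. *)
Lemma row_dominant_perturb n (H K : 'M[C]_n) :
  H \is hermsymmx -> K \is hermsymmx -> row_dominant H ->
  exists2 e, 1 < e & row_dominant (H - e^-1 *: K).
Proof.
move=> hH hK dH.
have [||e e1 eP] := @uniform_multiplier _ (fun i => \sum_j `|K i j|)
  (fun i => H i i - \sum_(j | j != i) `|H i j|).
- by move=> i; rewrite sumr_ge0.
- by move=> i; rewrite subr_gt0.
exists e => // i; have e0 : 0 < e := lt_trans ltr01 e1.
rewrite !mxE ltrBrDr.
have : e^-1 * \sum_j `|K i j| < H i i - \sum_(j | j != i) `|H i j|.
  by rewrite mulrC ltr_pdivrMr // mulrC.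
rewrite ltrBrDl; apply: le_lt_trans.
rewrite [\sum_j `|K i j|](bigD1 i) //= mulrDr addrCA [leRHS]addrC mulr_sumr.
apply: lerD; last first.
  by rewrite ler_wpM2l ?invr_ge0 ?(ltW e0) // real_ler_norm // hermsymmx_diag_real.
rewrite -big_split; apply: ler_sum => j _ /=.
rewrite !mxE (le_trans (ler_normB _ _)) //.
by rewrite normrM [`|e^-1|]gtr0_norm ?invr_gt0.
Qed.

(* [D] is the diagonal matrix of the [h^-i], so that [S i j = h^(j - i) T i j]. *)
Lemma is_trig_mx_scaling n (T : 'M[C]_n) :
  is_trig_mx T -> (forall i, 0 < T i i + (T i i)^*) ->
  exists D S : 'M[C]_n,
    [/\ D \in unitmx, S *m D = D *m T & row_dominant (S + S^t*)].
Proof.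
move=> /is_trig_mxP trigT T0.
(* Row and column sums both enter because entry [(i, j)] of [S + S^t*] mixes [T i j] with the
   conjugate of [T j i]. *)
have [||h h1 hP] := @uniform_multiplier _
  (fun i => \sum_j (`|T i j| + `|T j i|)) (fun i => T i i + (T i i)^*).
- by move=> i; rewrite sumr_ge0 // => j _; rewrite addr_ge0.
- by [].
have h0 : 0 < h := lt_trans ltr01 h1.
have hn0 : h != 0 by rewrite gt_eqF.
pose D : 'M[C]_n := diag_mx (\row_i h ^- i).
pose E : 'M[C]_n := diag_mx (\row_i h ^+ i).
have ED : E *m D = 1%:M.
  apply/matrixP => i j; rewrite mul_mx_diag !mxE.
  by case: eqP => [->|_]; rewrite ?mulr1n ?mul0r // divff // expf_neq0.
have SE i j : (D *m T *m E) i j = h ^- i * T i j * h ^+ j.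
  by rewrite mul_mx_diag mul_diag_mx !mxE.
(* Above the diagonal [T] vanishes; below it the factor is [h^(j - i)] with [i - j >= 1]. *)
have S_le i j : j != i -> `|(D *m T *m E) i j| <= h^-1 * `|T i j|.
  rewrite SE => ji; have [lij|lji] := ltnP i j.
    by rewrite trigT // mulr0 mul0r normr0 mulr0.
  have {ji}lji : (j < i)%N by rewrite ltn_neqAle lji andbT.
  rewrite mulrAC normrM ler_wpM2r // -(subnK lji) -addSnnS exprD.
  rewrite invfM -mulrA mulVf ?expf_neq0 // mulr1 normfV normrX gtr0_norm //.
  by rewrite lef_pV2 ?posrE ?exprn_gt0 // exprS ler_peMr ?(ltW h0) // exprn_ege1 // ltW.
exists D, (D *m T *m E); split; first by have [] := mulmx1_unit ED.
  by rewrite -mulmxA ED mulmx1.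
move=> i; have -> : (D *m T *m E + (D *m T *m E)^t*) i i = T i i + (T i i)^*.
  rewrite mxE trmxCE SE mulrAC mulVf ?mul1r ?expf_neq0 //.
have : h^-1 * \sum_j (`|T i j| + `|T j i|) < T i i + (T i i)^*.
  by rewrite mulrC ltr_pdivrMr // mulrC.
apply: le_lt_trans.
rewrite [\sum_j (`|T i j| + `|T j i|)](bigD1 i) //= mulrDr ler_wpDl //.
  by rewrite mulr_ge0 ?addr_ge0 // invr_ge0 ltW.
rewrite mulr_sumr; apply: ler_sum => j ji.
rewrite mxE trmxCE (le_trans (ler_normD _ _)) // norm_conjC mulrDr.
by rewrite lerD // S_le // eq_sym.
Qed.

(** * Existence of the form [P] *)

Lemma lyapunov_row_dominant n (A : 'M[C]_n) : (0 < n)%N ->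
  (forall a, eigenvalue A a -> 0 < a + a^*) ->
  exists U S : 'M[C]_n,
    [/\ U \in unitmx, S *m U = U *m A & row_dominant (S + S^t*)].
Proof.
move=> n_gt0 eigA; have [V Vun] := Schur A n_gt0.
have Vu := unitarymx_unit Vun.
rewrite /similar_to /= conjumx // => trigT.
set T := V *m A *m invmx V in trigT.
have TV : T *m V = V *m A by rewrite mulmxKV.
(* The diagonal of the triangular [T] consists of eigenvalues; a row eigenvector [v] of [T] gives
   the row eigenvector [v *m V] of [A]. *)
have T_gt0 i : 0 < T i i + (T i i)^*.
  apply: eigA; have : eigenvalue T (T i i).
    rewrite eigenvalue_root_char char_poly_trig //.
    rewrite -(big_map _ predT (fun x => 'X - x%:P)) root_prod_XsubC.
    by apply/mapP; exists i; rewrite ?mem_index_enum.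
  case/eigenvalueP => v vT v0; apply/eigenvalueP; exists (v *m V).
    by rewrite -mulmxA -TV mulmxA vT scalemxAl.
  by apply: contra_neq v0 => vV; rewrite -[v](mulmxK Vu) vV mul0mx.
have [D [S [Du SD dS]]] := is_trig_mx_scaling trigT T_gt0.
exists (D *m V), S; split=> //; first by rewrite unitmx_mul Du.
by rewrite mulmxA SD -mulmxA TV mulmxA.
Qed.

(** With [P = U^t* *m U], the coordinates [U *m v] turn [P] into the identity and [A] into [S], so
    the required form is congruent to [S + S^t* - e^-1 *: (S^t* *m S + 1%:M)]. *)
Lemma exists_lyapunov_form n (A : 'M[C]_n) : (0 < n)%N ->
  (forall a, eigenvalue A a -> 0 < a + a^*) ->
  exists e (P : 'M[C]_n),
    [/\ 1 < e, P \is hermsymmx, forall v, v != 0 -> 0 < qform P v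
      & forall v, v != 0 ->
          0 < qform (P *m A + A^t* *m P - e^-1 *: (A^t* *m P *m A + P)) v].
Proof.
move=> n_gt0 eigA; have [U [S [Uu SU dH]]] := lyapunov_row_dominant n_gt0 eigA.
have hH : S + S^t* \is hermsymmx.
  by apply/hermsymmxP; rewrite trmxCD trmxC_invol addrC.
have hK : S^t* *m S + 1%:M \is hermsymmx.
  by apply/hermsymmxP; rewrite trmxCD trmxC_mul trmxC_invol trmxC1.
have [e e1 dM] := row_dominant_perturb hH hK dH.
have Uv0 (v : 'cV[C]_n) : v != 0 -> U *m v != 0.
  by apply: contra_neq => Uv; rewrite -[v](mulKmx Uu) Uv mulmx0.
exists e, (U^t* *m U); split=> //.
- by apply/hermsymmxP; rewrite trmxC_mul trmxC_invol.
- move=> v v0; rewrite -[U^t*]mulmx1 qform_congr.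
  apply: row_dominant_qform_gt0 (Uv0 _ v0).
    by apply/hermsymmxP; rewrite trmxC1.
  move=> i; rewrite big1 ?mxE ?eqxx ?ltr01 // => j ji.
  by rewrite mxE eq_sym (negbTE ji) normr0.
have US : A^t* *m U^t* = U^t* *m S^t* by rewrite -!trmxC_mul SU.
have -> : U^t* *m U *m A + A^t* *m (U^t* *m U)
    - e^-1 *: (A^t* *m (U^t* *m U) *m A + U^t* *m U)
  = U^t* *m (S + S^t* - e^-1 *: (S^t* *m S + 1%:M)) *m U.
  have E1 : U^t* *m S *m U = U^t* *m U *m A by rewrite -mulmxA SU mulmxA.
  have E2 : U^t* *m S^t* *m U = A^t* *m (U^t* *m U) by rewrite -US -mulmxA.
  have E3 : U^t* *m (S^t* *m S) *m U = A^t* *m (U^t* *m U) *m A.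
    by rewrite mulmxA -US -mulmxA SU !mulmxA.
  rewrite mulmxBr mulmxBl -scalemxAr -scalemxAl !mulmxDr !mulmxDl mulmx1.
  by rewrite E1 E2 E3.
move=> v v0; rewrite qform_congr.
apply: row_dominant_qform_gt0 (Uv0 _ v0) => //.
apply/hermsymmxP; rewrite trmxCB trmxCZ (hermsymmxP _ hH) (hermsymmxP _ hK).
by rewrite conj_Creal // rpredV ger0_real // ltW // (lt_trans ltr01).
Qed.

(** * Cayley transform and the map [A |-> (A + A^-1) / 2] *)

(** Multiplied by [2 * e], the left matrix is [(e - 1) (A + 1)^* P (A + 1) - (e + 1) (A - 1)^* P (A
    - 1)]. This is the contraction property without inverting [A + 1]. *)
Lemma qform_cayley n e (P A : 'M[C]_n) v : 0 < e ->
  (0 < qform (P *m A + A^t* *m P - e^-1 *: (A^t* *m P *m A + P)) v) =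
  ((e + 1) * qform P ((A - 1%:M) *m v) < (e - 1) * qform P ((A + 1%:M) *m v)).
Proof.
move=> e0; rewrite -!qform_congr -[RHS]subr_gt0 -!qformZ -qformB.
rewrite trmxCB trmxCD trmxC1.
rewrite -[LHS](pmulr_rgt0 _ (mulr_gt0 (ltr0n C 2) e0)) -qformZ.
congr (0 < qform _ v).
rewrite mulmxBl mulmxDl mul1mx mulmxBr !mulmxDr mulmxDl mulmxBl !mulmx1.
apply/matrixP => i j; rewrite !mxE; field.
by rewrite gt_eqF.
Qed.

(** Writing [v = A *m w], the vectors [(B - 1) v] and [(B + 1) v] are half of [(A - 1)^2 w] and
    [(A + 1)^2 w], so the contraction estimate is applied twice. *)
Lemma qform_cayley_joukowski n e (P A : 'M[C]_n) :
  A \in unitmx -> 1 < e -> (forall v, v != 0 -> 0 < qform P v) ->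
  (forall v, v != 0 ->
    (e + 1) * qform P ((A - 1%:M) *m v) < (e - 1) * qform P ((A + 1%:M) *m v)) ->
  let z := 2^-1 * (e + e^-1) in let B := 2^-1 *: (A + invmx A) in
  forall v, v != 0 ->
    (z + 1) * qform P ((B - 1%:M) *m v) < (z - 1) * qform P ((B + 1%:M) *m v).
Proof.
move=> Au e1 Ppos cayA z B v v0.
have e0 : 0 < e := lt_trans ltr01 e1.
have en0 : e != 0 by rewrite gt_eqF.
pose a := A - 1%:M; pose b := A + 1%:M; pose w := invmx A *m v.
have w0 : w != 0.
  by apply: contra_neq v0 => wE; rewrite -[v](mulKVmx Au) -/w wE mulmx0.
have vE : v = A *m w by rewrite mulKVmx.
have P_ge0 u : 0 <= qform P u.
  by have [->|/Ppos/ltW//] := eqVneq u 0; rewrite qform0.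
(* Otherwise the estimate at [w] would make a nonnegative quantity negative. *)
have bw0 : b *m w != 0.
  apply/eqP => bw; have := cayA w w0; rewrite -/a -/b bw qform0 mulr0.
  by rewrite le_gtF // mulr_ge0 // addr_ge0 // ltW.
have ab : a *m b = b *m a.
  rewrite /a /b mulmxDr mulmxBr mulmxBl [in RHS]mulmxDl !mul1mx !mulmx1.
  by rewrite addrA subrK opprD addrA addrK.
have aw : a *m w = v - w by rewrite mulmxBl mul1mx -vE.
have bw : b *m w = v + w by rewrite mulmxDl mul1mx -vE.
have Bv : B *m v = 2^-1 *: (A *m v + w) by rewrite -scalemxAl mulmxDl.
have Baa : (B - 1%:M) *m v = 2^-1 *: (a *m (a *m w)).
  rewrite aw mulmxBl Bv mul1mx mulmxBr aw mulmxBl mul1mx.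
  by apply/matrixP => i j; move: (A *m v) => u; rewrite !mxE; field.
have Bbb : (B + 1%:M) *m v = 2^-1 *: (b *m (b *m w)).
  rewrite bw mulmxDl Bv mul1mx mulmxDr bw mulmxDl mul1mx.
  by apply/matrixP => i j; move: (A *m v) => u; rewrite !mxE; field.
(* [a *m w] may vanish, so this estimate is weak; strictness comes from the one at [b *m w]. *)
have caw : (e + 1) * qform P (a *m (a *m w)) <= (e - 1) * qform P (b *m (a *m w)).
  have [->|/cayA/ltW//] := eqVneq (a *m w) 0.
  by rewrite !mulmx0 qform0 !mulr0.
have := cayA _ bw0; rewrite -/a -/b mulmxA ab -mulmxA => cbw.
rewrite Baa Bbb !qformZv.
have e_1 : 0 < e - 1 by rewrite subr_gt0.
have e_2 : 0 < e + 1 by rewrite addr_gt0.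
have -> : z + 1 = (2 * e)^-1 * (e + 1) * (e + 1) by rewrite /z; field.
have -> : z - 1 = (2 * e)^-1 * (e - 1) * (e - 1) by rewrite /z; field.
rewrite !(mulrCA _ (`|2^-1| ^+ 2)) ltr_pM2l ?exprn_gt0 ?normr_gt0 ?invr_eq0 ?pnatr_eq0 //.
rewrite -!(mulrA (2 * e)^-1) ltr_pM2l ?invr_gt0 ?mulr_gt0 //.
(* The mixed vector [b a w = a b w] links the two estimates. *)
apply: le_lt_trans (_ : _ <= (e + 1) * ((e - 1) * qform P (b *m (a *m w)))) _.
  by rewrite -mulrA ler_pM2l.
by rewrite mulrCA -mulrA ltr_pM2l.
Qed.

End HermitianForms.

Local Open Scope complex_scope.

(** Only positivity remains to be checked: the difference is Hermitian because [P] is and [eta] is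
    real. *)
Lemma LP_qformP (R : realType) (n : nat) (P A : 'M[R[i]]_n) (eta : R) :
  P \is hermsymmx ->
  LP P eta A <-> forall v, v != 0 ->
    0 < qform (P *m A + A^t* *m P - (eta%:C)^-1 *: (A^t* *m P *m A + P)) v.
Proof.
move=> /hermsymmxP hP; rewrite /LP /= /mxsucc /posdefmx fmorphV.
split=> [[]//|hq]; split=> //; apply/hermsymmxP.
rewrite trmxCB trmxCZ !trmxCD !trmxC_mul trmxC_invol hP mulmxA (addrC (A^t* *m P)).
by rewrite conj_Creal // rpredV; apply/CrealP; exact: conjc_real.
Qed.

Theorem proposition5p6 (R : realType) (n : nat) (n_gt0 : (0 < n)%N)
    (A : 'M[R[i]]_n)
    (specA : spectrum A `<=` [set z : R[i] | 0 < complex.Re z]) :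
  (exists (eta : R) (P : 'M[R[i]]_n),
     [/\ 1 < eta, posdefmx P, LP P eta A
       & exists P' : 'M[R[i]]_n, [/\ P' <> P, posdefmx P' & LP P' eta A]]) /\
  A \in unitmx /\
  (forall (eta : R) (P : 'M[R[i]]_n),
     1 < eta -> posdefmx P -> LP P eta A ->
     1 < 2^-1 * (eta + eta^-1) /\
     LP P (2^-1 * (eta + eta^-1)) (2^-1 *: (A + invmx A))).
Proof.
(* The kernel of [A] is its eigenspace at 0, and 0 lies outside the open half-plane. *)
have Au : A \in unitmx.
  rewrite -row_free_unit -kermx_eq0; apply: contraT => kerA0.
  have /specA : eigenvalue A 0 by rewrite /eigenvalue /eigenspace raddf0 subr0.
  by rewrite /= ltxx.
split; last first.
  split; first exact: Au.
  move=> eta P eta1 [hP Ppos] /(LP_qformP _ _ hP) hA.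
  have eta0 : 0 < eta := lt_trans ltr01 eta1.
  have z1 : 1 < 2^-1 * (eta + eta^-1).
    have -> : 2^-1 * (eta + eta^-1) = 1 + (eta - 1) ^+ 2 / (2 * eta).
      by field; rewrite gt_eqF.
    by rewrite ltrDl divr_gt0 ?exprn_gt0 ?subr_gt0 ?mulr_gt0.
  split; [exact: z1|apply/(LP_qformP _ _ hP) => v v0].
  have e0 : 0 < eta%:C by rewrite ltcR.
  rewrite qform_cayley ?ltcR ?(lt_trans ltr01) // rmorphM rmorphD !fmorphV rmorph_nat.
  apply: qform_cayley_joukowski => //; first by rewrite ltcR.
  by move=> u u0; rewrite -qform_cayley // hA.
have eigA a : eigenvalue A a -> 0 < a + Num.conj a.
  move=> /specA /= a0; have -> : a + Num.conj a = 2 * (complex.Re a)%:C.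
    exact: addcJ.
  by rewrite mulr_gt0 // ltcR.
have [e [P [e1 hP Ppos hA]]] := exists_lyapunov_form n_gt0 eigA.
(* [e] lives in [R[i]], but [1 < e] forces it to be real, so its real part serves as [eta]. *)
have eE : e = (complex.Re e)%:C.
  by rewrite RRe_real // ger0_real // ltW // (lt_trans ltr01).
exists (complex.Re e), P; split; first by rewrite -ltcR -eE.
- by [].
- by apply/(LP_qformP _ _ hP); rewrite -eE.
(* Non-uniqueness: all conditions are homogeneous in [P], so [2 *: P] also works. It differs from
   [P] because the form is positive at a nonzero vector, which exists by [n_gt0]. *)
have P2 : 2 *: P \is hermsymmx.
  by apply/hermsymmxP; rewrite trmxCZ (hermsymmxP _ hP) conj_Creal ?realn.
exists (2 *: P); split.
- pose v : 'cV[R[i]]_n := const_mx 1.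
  have /Ppos : v != 0.
    by apply/eqP => /matrixP/(_ (Ordinal n_gt0) 0); rewrite !mxE => /eqP; rewrite oner_eq0.
  move=> Pv PP; have := qformZ 2 P v; rewrite PP mulr_natl mulr2n => /esym/eqP.
  by rewrite -subr_eq0 addrK gt_eqF.
- split=> [|v v0]; first exact: P2.
  by rewrite -/(qform _ v) qformZ mulr_gt0 ?Ppos.
apply/(LP_qformP _ _ P2) => v v0; rewrite -eE.
rewrite -scalemxAl -!scalemxAr -scalemxAl -!scalerDr scalerA mulrC -scalerA -scalerBr.
by rewrite qformZ mulr_gt0 // hA.
Qed.
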